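(* Let $\alpha,\beta,\gamma,\delta\in(0,\pi)$ with $\delta=\pi-\alpha$, $\gamma=\pi-\beta$, $\beta\neq\alpha$, $\alpha+\beta\neq\pi$ (an ''anti-deltoid I''). Then the configuration space of the spherical 4-bar linkage with sector angles $\alpha,\beta,\gamma,\delta$ is the union of the following two branches, each diffeomorphic to a circle $S^1$: the set of all $(x,y,z,w)=(t,0,t,0)$, $t\in\mathbb{R}\cup\{\infty\}$, and the set of all $(x,y,z,w)$ with $$x=t,\quad y^{-1}=-\frac{\sin(\beta-\alpha)t^2+\sin(\beta+\alpha)}{2t\sin\alpha},\quad z=-t,\quad w^{-1}=-\frac{\sin(\alpha-\beta)t^2+\sin(\alpha+\beta)}{2t\sin\beta},\qquad t\in\mathbb{R}\cup\{\infty\}.$$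
   Context: A configuration of the spherical 4-bar linkage (degree-4 single-vertex rigid origami) with sector angles $\alpha,\beta,\gamma,\delta\in(0,\pi)$ is a quadruple of folding angles $(\rho_x,\rho_y,\rho_z,\rho_w)\in(\mathbb{R}/2\pi\mathbb{Z})^4$ satisfying the closure condition $$R_3(\alpha)R_1(\rho_x)R_3(\beta)R_1(\rho_y)R_3(\gamma)R_1(\rho_z)R_3(\delta)R_1(\rho_w)=I,$$ where $R_1(\theta),R_3(\theta)\in SO(3)$ are the rotations by $\theta$ about the first and third coordinate axes. (Panel $\alpha$ lies between creases $w$ and $x$, $\beta$ between $x$ and $y$, $\gamma$ between $y$ and $z$, $\delta$ between $z$ and $w$.) Configurations are recorded by $x=\tan(\rho_x/2)$, $y=\tan(\rho_y/2)$, $z=\tan(\rho_z/2)$, $w=\tan(\rho_w/2)$ in $\mathbb{R}\cup\{\infty\}$, the one-point compactification (a folding angle $\pi$ corresponds to $\infty$; $-\infty$ and $\infty$ are identified), which is identified as a smooth manifold with the circle $\mathbb{R}/2\pi\mathbb{Z}$. The configuration space is the set of all such $(x,y,z,w)\in(\mathbb{R}\cup\{\infty\})^4$. Here $0^{-1}=\infty$, $\infty^{-1}=0$, and rational functions of $t$ are extended by continuity to maps $\mathbb{R}\cup\{\infty\}\to\mathbb{R}\cup\{\infty\}$. *)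

(* Defs.v *)
From HB Require Import structures.
From mathcomp Require Import all_boot all_order all_algebra.
From mathcomp Require Import ring.
From mathcomp Require Import all_classical all_reals all_analysis.

Set Implicit Arguments.
Unset Strict Implicit.
Unset Printing Implicit Defensive.

Import Order.TTheory GRing.Theory Num.Theory.
Import numFieldNormedType.Exports.

Local Open Scope classical_set_scope.
Local Open Scope ring_scope.

(* R \cup {oo}: [Some t] is the real number t and [None] is oo. *)
Notation Rhat R := (one_point_compactification R).

Definition Rhat4 (R : realType) : Type := (Rhat R * Rhat R * Rhat R * Rhat R)%type.

Definition inv_hat (R : realType) (t : Rhat R) : Rhat R :=
  if t is Some a then (if a == 0 then None else Some a^-1) else Some 0.

(* -oo and oo are the same point. *)
Definition opp_hat (R : realType) (t : Rhat R) : Rhat R := omap -%R t.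

(* Extension by continuity of a rational function f to R \cup {oo}: its value at
   t is the limit, in R \cup {oo}, of f s as s tends to t with s <> t.  The
   values given to f at its poles (where x / 0 = 0) and to [omap f] at oo play
   no role, since they are avoided by small punctured neighbourhoods. *)
Definition cont_ext (R : realType) (f : R -> R) (t : Rhat R) : Rhat R :=
  lim ((omap f s : Rhat R) @[s --> (t : Rhat R)^']).

Definition mx3 (R : realType) (s : seq (seq R)) : 'M[R]_3 :=
  \matrix_(i, j) nth 0 (nth [::] s i) j.

Definition rot1 (R : realType) (a : R) : 'M[R]_3 :=
  mx3 [:: [:: 1; 0; 0];
          [:: 0; cos a; - sin a];
          [:: 0; sin a; cos a]].

Definition rot3 (R : realType) (a : R) : 'M[R]_3 :=
  mx3 [:: [:: cos a; - sin a; 0];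
          [:: sin a; cos a; 0];
          [:: 0; 0; 1]].

(* The folding angles are given by real representatives; the condition is
   2pi-periodic in each of them. *)
Definition closure_condition (R : realType) (alpha beta gamma delta : R)
    (rx ry rz rw : R) : Prop :=
  rot3 alpha *m rot1 rx *m rot3 beta *m rot1 ry *m
  rot3 gamma *m rot1 rz *m rot3 delta *m rot1 rw = 1%:M.

(* The bijection R/2piZ -> R \cup {oo}, rho |-> tan (rho / 2). *)
Definition tan_half (R : realType) (rho : R) : Rhat R :=
  if cos (rho / 2) == 0 then None else Some (tan (rho / 2)).

Definition config_space (R : realType) (alpha beta gamma delta : R) :
    set (Rhat4 R) :=
  [set p | exists rx ry rz rw : R,
     closure_condition alpha beta gamma delta rx ry rz rw /\
     p = (tan_half rx, tan_half ry, tan_half rz, tan_half rw)].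

Definition branch1 (R : realType) : set (Rhat4 R) :=
  [set p | exists t : Rhat R, p = (t, Some 0, t, Some 0)].

Definition branch2 (R : realType) (alpha beta : R) : set (Rhat4 R) :=
  [set p | let: (x, y, z, w) := p in exists t : Rhat R,
     [/\ x = t,
         inv_hat y = cont_ext (fun s => - ((sin (beta - alpha) * s ^+ 2
                       + sin (beta + alpha)) / (2 * s * sin alpha))) t,
         z = opp_hat t &
         inv_hat w = cont_ext (fun s => - ((sin (alpha - beta) * s ^+ 2
                       + sin (alpha + beta)) / (2 * s * sin beta))) t]].

(* The identification of R \cup {oo} with the unit circle: tan (rho / 2) is sent
   to (cos rho, sin rho), see [circle_coords_tan_half]. *)
Definition circle_coords (R : realType) (t : Rhat R) : R * R :=
  if t is Some a then ((1 - a ^+ 2) / (1 + a ^+ 2), 2 * a / (1 + a ^+ 2))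
  else (-1, 0).

Lemma circle_coords_tan_half (R : realType) (rho : R) :
  circle_coords (tan_half rho) = (cos rho, sin rho).
Proof.
have -> : rho = rho / 2 + rho / 2 by field.
set h := rho / 2; rewrite /tan_half.
have -> : (h + h) / 2 = h by field.
have cs := cos2Dsin2 h.
rewrite cosD sinD; case: eqP => [c0|/eqP c0] /=.
  move: cs; rewrite c0 expr0n add0r !mul0r !mulr0 sub0r -expr2 => ->.
  by rewrite addr0.
have dE : 1 + tan h ^+ 2 = (cos h ^+ 2)^-1.
  by rewrite -[X in X + _](divff (expf_neq0 2 c0)) expr_div_n -mulrDl cs mul1r.
rewrite dE invrK /tan; congr pair; field; exact: c0.
Qed.

(* The 4-torus (R \cup {oo})^4, i.e. (R/2piZ)^4, as a submanifold of R^8. *)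
Definition torus_embed (R : realType) (p : Rhat4 R) : 'rV[R]_8 :=
  let: (x, y, z, w) := p in
  \row_(j < 8) nth 0
    [:: (circle_coords x).1; (circle_coords x).2;
        (circle_coords y).1; (circle_coords y).2;
        (circle_coords z).1; (circle_coords z).2;
        (circle_coords w).1; (circle_coords w).2] j.

Definition unit_circle (R : realType) : set 'rV[R]_2 :=
  [set v | v 0 0 ^+ 2 + v 0 1 ^+ 2 = 1].

(* f is of class C^k on U (meant for U open): all its iterated partial
   derivatives of order at most k exist and are continuous on U. *)
Fixpoint class_C (R : realType) (n : nat) (k : nat) (U : set 'rV[R]_n.+1)
    (f : 'rV[R]_n.+1 -> R) : Prop :=
  (forall x, U x -> {for x, continuous f}) /\
  (if k is k'.+1 then
     forall i : 'I_n.+1,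
       (forall x, U x -> derivable f x (delta_mx 0 i : 'rV[R]_n.+1)) /\
       class_C k' U (fun x => 'D_(delta_mx 0 i : 'rV[R]_n.+1) f x)
   else True).

(* Smooth maps and diffeomorphisms between arbitrary subsets of Euclidean
   spaces, in the sense of Milnor: a map on A is smooth if near each point of A
   it extends to a C^oo map on an open subset of the ambient space. *)
Definition smooth_on (R : realType) (m n : nat) (A : set 'rV[R]_m.+1)
    (f : 'rV[R]_m.+1 -> 'rV[R]_n.+1) : Prop :=
  forall x, A x -> exists (U : set 'rV[R]_m.+1)
                          (g : 'rV[R]_m.+1 -> 'rV[R]_n.+1),
    [/\ open U, U x,
        forall (j : 'I_n.+1) (k : nat), class_C k U (fun y => g y 0 j) &
        forall y, A y -> U y -> g y = f y].

Definition diffeomorphic (R : realType) (m n : nat) (A : set 'rV[R]_m.+1)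
    (B : set 'rV[R]_n.+1) : Prop :=
  exists (f : 'rV[R]_m.+1 -> 'rV[R]_n.+1) (g : 'rV[R]_n.+1 -> 'rV[R]_m.+1),
    [/\ smooth_on A f /\ smooth_on B g,
        forall x, A x -> B (f x) /\ g (f x) = x &
        forall y, B y -> A (g y) /\ f (g y) = y].

Definition diffeomorphic_to_circle (R : realType) (B : set (Rhat4 R)) : Prop :=
  diffeomorphic (@unit_circle R) (@torus_embed R @` B).

(* Main.v *)
Require Import Defs.
From mathcomp Require Import all_boot all_order all_algebra.
From mathcomp Require Import ring lra.
From mathcomp Require Import all_classical all_reals all_analysis.
Import Order.TTheory GRing.Theory Num.Theory.
Import numFieldNormedType.Exports.
Local Open Scope classical_set_scope.
Local Open Scope ring_scope.

(* Lift the closure condition to unit quaternions.  Since R_3(pi) R_1(r) R_3(pi)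
   = R_1(-r), it says that X (Y conjugated by B) Z^-1 = +- W^-1 conjugated by
   A^-1, where X, Y, Z, W, A, B are the quaternions of the rotations by the
   folding angles, alpha and beta.  One component of this equation is
   sin beta sin(rho_y/2) sin((rho_x + rho_z)/2) = 0.  If sin(rho_y/2) = 0, the
   others give y = w = 0 and z = x; otherwise z = -x, and they determine
   cot(rho_y/2) and cot(rho_w/2) as functions of rho_x.  On each branch the
   coordinates are rational functions of (cos rho_x, sin rho_x) with nonvanishing
   denominators, so the projection to x is a diffeomorphism onto the circle. *)

(** * Smooth functions on the whole space *)

Section smooth_functions.
Context {R : realType} {n : nat}.
Implicit Types (f g : 'rV[R]_n.+1 -> R) (k : nat) (a : R).
Local Notation class k f := (@class_C R n k setT f).

Lemma class_CW k f : class k.+1 f -> class k f.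
Proof.
elim: k f => [|k IH] f [cf df]; split => // i.
by have [dfi Cf] := df i; split => //; exact: IH.
Qed.

Lemma class_C_cst k a : class k (cst a).
Proof.
elim: k a => [|k IH] a.
  by split=> [x _|//]; exact: cst_continuous.
split=> [x _|i]; first exact: cst_continuous.
split=> [x _|]; first exact: derivable_cst.
rewrite (_ : (fun _ => _) = cst 0); first exact: IH.
by apply/funext => x; rewrite derive_cst.
Qed.

Lemma is_derive_coord (x v : 'rV[R]_n.+1) (j : 'I_n.+1) :
  is_derive x v (fun u : 'rV[R]_n.+1 => u 0 j) (v 0 j).
Proof.
have h : (fun t : R => t^-1 *: ((t *: v + x) 0 j - x 0 j)) @ 0^'
    --> v 0 j.
  (* Off [t = 0] the difference quotient is constantly [v 0 j]. *)
  apply: cvg_near_cst; near=> t.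
  rewrite !mxE addrK; apply: scalerK; near: t; exact: nbhs_dnbhs_neq.
by apply: DeriveDef; [apply/cvg_ex; exists (v 0 j) | exact: cvg_lim].
Unshelve. all: by end_near. Qed.

Lemma class_C_coord k (j : 'I_n.+1) : class k (fun x => x 0 j).
Proof.
case: k => [|k].
  by split=> [x _|//]; exact: coord_continuous.
split=> [x _|i]; first exact: coord_continuous.
split=> [x _|]; first by have := is_derive_coord x (delta_mx 0 i) j; case.
rewrite (_ : (fun _ => _) = cst ((delta_mx 0 i : 'rV[R]_n.+1) 0 j)).
  exact: class_C_cst.
by apply/funext => x; case: (is_derive_coord x (delta_mx 0 i) j).
Qed.

Lemma class_CD k f g : class k f -> class k g -> class k (f \+ g).
Proof.
elim: k f g => [|k IH] f g [cf df] [cg dg].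
  by split=> [x _|//]; exact: continuousD (cf x I) (cg x I).
split=> [x _|i]; first exact: continuousD (cf x I) (cg x I).
have [[dfi Cf] [dgi Cg]] := (df i, dg i).
split=> [x _|]; first exact: derivableD (dfi x I) (dgi x I).
rewrite (_ : (fun _ => _) = (fun x => 'D_(delta_mx 0 i) f x) \+
  (fun x => 'D_(delta_mx 0 i) g x)); first exact: IH.
by apply/funext => x; rewrite deriveD //; [exact: dfi|exact: dgi].
Qed.

(** Induction on [k]: the Leibniz rule involves [f] and [g] besides their partial derivatives, and
    [class_CW] lowers the order of [f] and [g] to that of the induction hypothesis. *)
Lemma class_CM k f g : class k f -> class k g -> class k (f \* g).
Proof.
elim: k f g => [|k IH] f g Cf0 Cg0.
  case: Cf0 => cf _; case: Cg0 => cg _.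
  by split=> [x _|//]; exact: continuousM (cf x I) (cg x I).
have [[cf df] [cg dg]] := (Cf0, Cg0).
split=> [x _|i]; first exact: continuousM (cf x I) (cg x I).
have [[dfi Cf] [dgi Cg]] := (df i, dg i).
split=> [x _|]; first exact: derivableM (dfi x I) (dgi x I).
rewrite (_ : (fun _ => _) = (f \* (fun x => 'D_(delta_mx 0 i) g x)) \+
  (g \* (fun x => 'D_(delta_mx 0 i) f x))).
  by apply: class_CD; apply: IH => //; exact: class_CW.
by apply/funext => x; rewrite deriveM //; [exact: dfi|exact: dgi].
Qed.

(** The partial derivatives are those of [f] times minus the square of the inverse, and the inverse
    is already of class [k] by induction. *)
Lemma class_CV k f : (forall x, f x != 0) ->
  class k f -> class k (fun x => (f x)^-1).
Proof.
move=> f0; elim: k => [|k IH] Cf0.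
  by case: Cf0 => cf _; split=> [x _|//]; exact: continuousV (cf x I).
have [cf df] := Cf0.
split=> [x _|i]; first exact: continuousV (cf x I).
have [dfi Cf] := df i.
split=> [x _|]; first exact: derivableV (dfi x I).
have CV := IH (class_CW _ _ Cf0).
rewrite (_ : (fun _ => _) = (cst (-1) \* ((fun x => (f x)^-1) \*
  (fun x => (f x)^-1))) \* (fun x => 'D_(delta_mx 0 i) f x)).
  by do ![apply: class_CM => //]; exact: class_C_cst.
apply/funext => x; rewrite deriveV //; last exact: dfi.
by rewrite /= mulN1r -expr2 -exprVn.
Qed.

Definition smooth_fun f := forall k, class k f.

Lemma smooth_cst a : smooth_fun (fun _ => a).
Proof. by move=> k; exact: class_C_cst. Qed.

Lemma smooth_coord j : smooth_fun (fun v => v 0 j).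
Proof. by move=> k; exact: class_C_coord. Qed.

Lemma smoothD f g : smooth_fun f -> smooth_fun g ->
  smooth_fun (fun v => f v + g v).
Proof. by move=> sf sg k; exact: class_CD. Qed.

Lemma smoothM f g : smooth_fun f -> smooth_fun g ->
  smooth_fun (fun v => f v * g v).
Proof. by move=> sf sg k; exact: class_CM. Qed.

Lemma smoothN f : smooth_fun f -> smooth_fun (fun v => - f v).
Proof.
move=> sf; rewrite (_ : (fun _ => _) = (fun v => -1 * f v)).
  exact: (smoothM _ _ (smooth_cst _)).
by apply/funext => v; rewrite mulN1r.
Qed.

Lemma smoothV f : (forall v, f v != 0) -> smooth_fun f ->
  smooth_fun (fun v => (f v)^-1).
Proof. by move=> f0 sf k; exact: class_CV. Qed.

Lemma smoothX f m : smooth_fun f -> smooth_fun (fun v => f v ^+ m).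
Proof.
move=> sf; elim: m => [|m IH].
  by rewrite (_ : (fun _ => _) = (fun=> 1)); [exact: smooth_cst|exact/funext].
rewrite (_ : (fun _ => _) = (fun v => f v * f v ^+ m)); first exact: smoothM.
by apply/funext => v; rewrite exprS.
Qed.

End smooth_functions.

(** * Continuous extension to the projective line *)

Section continuous_extension.
Context {R : realType}.
Implicit Types (f : R -> R) (t : Rhat R) (a : R).

Lemma Rhat_hausdorff : hausdorff_space (Rhat R).
Proof.
apply: one_point_compactification_hausdorff; first exact: locally_compactR.
exact: Rhausdorff.
Qed.

(** The segment [-M, M] is compact and closed, so its complement together with infinity is a basic
    neighbourhood of infinity. *)
Lemma nbhs_infty (M : R) (U : set (Rhat R)) :
  (forall x : R, M < `|x| -> U (Some x)) -> U None ->
  nbhs (None : Rhat R) U.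
Proof.
move=> UM U0; exists `[(- M), M]%classic.
  split; [exact: segment_compact | exact: interval_closed].
move=> s [[x /= xM <-]|->//]; apply: UM.
by rewrite ltNge; apply/negP; rewrite ler_norml => xM'; apply: xM; rewrite in_itv.
Qed.

Lemma nbhs_infty_bound (U : set (Rhat R)) : nbhs (None : Rhat R) U ->
  exists M : R, forall x, M < `|x| -> U (Some x).
Proof.
case=> W [cW _] WU; have [M [_ WM]] := compact_bounded cW.
(* [compact_bounded] bounds [W] by every number above [M], for instance by [M + 1]. *)
exists (M + 1) => x xM; apply: WU; left; exists x => //= Wx.
have /(_ x Wx) /= := WM (M + 1) (ltr_pwDr ltr01 (lexx M)).
by rewrite leNgt xM.
Qed.

(** No point of the projective line is isolated; with the Hausdorff property this makes the limit in
    [cont_ext] unique. *)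
Lemma Rhat_dnbhs_proper t : ProperFilter (t^').
Proof.
apply: Build_ProperFilter_ex => U.
case: t => [a|].
  move=> h; have {}h : nbhs a (fun x : R => Some x != Some a -> U (Some x)) := h.
  have : (a^') (fun x : R => U (Some x)).
    by apply: filterS h => x /= h xa; apply: h; apply: contra xa => /eqP[->].
  by move/filter_ex => [x Ux]; exists (Some x).
rewrite /dnbhs /within /= => /nbhs_infty_bound[M h].
exists (Some (`|M| + 1)); apply: h => //.
by apply: (lt_le_trans _ (ler_norm _)); rewrite ltr_pwDr // ler_norm.
Qed.

Lemma cont_ext_lim f t (l : Rhat R) :
  ((omap f s : Rhat R) @[s --> t^'] --> l) -> cont_ext f t = l.
Proof.
move=> h; have P := Rhat_dnbhs_proper t; exact: (cvg_lim Rhat_hausdorff h).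
Qed.

Lemma cont_ext_continuous f a :
  {for a, continuous f} -> cont_ext f (Some a) = Some (f a).
Proof.
move=> cf; apply: cont_ext_lim => U fU.
have h : nbhs a (fun x : R => U (Some (f x))) := cf _ fU.
by apply: filterS h => x Ux _.
Qed.

Lemma cont_ext_pole f a : (forall M, \forall x \near a^', M < `|f x|) ->
  cont_ext f (Some a) = None.
Proof.
move=> cf; apply: cont_ext_lim => U /nbhs_infty_bound[M UM].
have h : nbhs a (fun x : R => x != a -> M < `|f x|) := cf M.
by apply: filterS h => x h xa; apply: UM; apply: h; apply: contra xa => /eqP ->.
Qed.

Lemma cont_ext_infty f :
  (forall M, exists K, forall x, K < `|x| -> M < `|f x|) ->
  cont_ext f None = None.
Proof.
move=> cf; apply: cont_ext_lim => U /nbhs_infty_bound[M UM].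
have [K KM] := cf M; rewrite /= /dnbhs /within /=.
by apply: (nbhs_infty K) => // x /KM /UM.
Qed.

(** Since [B] is nonzero, 0 is a pole; since [A] is nonzero, the numerator has larger degree than
    the denominator, so infinity is a pole too. Elsewhere the function is continuous. *)
Lemma cont_ext_quadratic (A B C : R) t : A != 0 -> B != 0 -> C != 0 ->
  cont_ext (fun s => - ((A * s ^+ 2 + B) / (2 * s * C))) t =
  if t is Some a then
    (if a == 0 then None else Some (- ((A * a ^+ 2 + B) / (2 * a * C))))
  else None.
Proof.
move=> A0 B0 C0.
have large (s M : R) : s != 0 -> `|2 * s * C| * M < `|A * s ^+ 2 + B| ->
    M < `|- ((A * s ^+ 2 + B) / (2 * s * C))|.
  move=> s0; rewrite normrN normf_div mulrC ltr_pdivlMr // normr_gt0.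
  by rewrite !mulf_neq0 ?pnatr_eq0.
case: t => [a|]; last first.
  apply: cont_ext_infty => M.
  (* The bound gives |x| > 1 and |A||x| > 2|C||M| + |B|; multiplying the latter by |x| and using |x|
     > 1 yields |A|x^2 > 2|x||C|M + |B|, and the reverse triangle inequality finishes. *)
  exists (1 + (2 * `|C| * `|M| + `|B|) / `|A|) => x xK.
  have A_gt0 : 0 < `|A| by rewrite normr_gt0.
  set D := 2 * `|C| * `|M| + `|B| in xK *.
  have D0 : 0 <= D by rewrite addr_ge0 // !mulr_ge0.
  have x1 : 1 < `|x| by apply: le_lt_trans xK; rewrite lerDl divr_ge0.
  have DA : D < `|A| * `|x|.
    rewrite -ltr_pdivrMl // mulrC; apply: le_lt_trans xK; lra.
  apply: large; first by rewrite -normr_gt0; lra.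
  have := lerB_dist (A * x ^+ 2) (- B).
  rewrite opprK normrN normrM normrX => h.
  apply: lt_le_trans h; rewrite ltrBrDr !normrM (ger0_norm (ler0n R 2)).
  have /le_lt_trans -> // : 2 * `|x| * `|C| * M + `|B| <= D * `|x|.
    rewrite /D [leRHS]mulrDl lerD //; last by rewrite ler_peMr // ltW.
    rewrite [leRHS](_ : _ = 2 * `|x| * `|C| * `|M|); last by ring.
    by rewrite ler_wpM2l ?ler_norm // !mulr_ge0.
  by rewrite expr2 mulrA ltr_pM2r //; lra.
case: eqVneq => [->|a0]; last first.
  apply: cont_ext_continuous; apply: continuousN.
  apply: continuousM.
    apply: continuousD; last exact: cst_continuous.
    apply: continuousM; first exact: cst_continuous.
    exact: exprn_continuous.
  apply: continuousV; first by rewrite !mulf_neq0 ?pnatr_eq0.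
  apply: continuousM; last exact: cst_continuous.
  by apply: continuousM; [exact: cst_continuous|].
apply: cont_ext_pole => M.
(* The criterion [large] asks for a negative value of this function, which is continuous at 0 with
   value -|B| there. *)
have cvL : (fun x : R => `|2 * x * C| * M - `|A * x ^+ 2 + B|) @ (0 : R)
    --> `|2 * 0 * C| * M - `|A * 0 ^+ 2 + B|.
  apply: cvgB.
    apply: cvgMr_tmp; apply: cvg_norm; apply: cvgMr_tmp.
    by apply: cvgMl_tmp.
  apply: cvg_norm; apply: cvgD; last exact: cvg_cst.
  by apply: cvgMl_tmp; exact: exprn_continuous.
have neg : `|2 * 0 * C| * M - `|A * 0 ^+ 2 + B| < 0.
  by rewrite expr0n /= !(mulr0, mul0r, normr0, add0r, sub0r) oppr_lt0 normr_gt0.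
have near0 := @cvgr_lt _ _ _ (nbhs_filter (0 : R)) _ _ cvL _ neg.
have dnear0 := nbhs_dnbhs near0.
near=> x; apply: large; first by near: x; exact: nbhs_dnbhs_neq.
by rewrite -subr_lt0; near: x.
Unshelve. all: by end_near. Qed.

End continuous_extension.

(** * Quaternions and the closure condition *)

Section quaternions.
Context {R : realType}.
Implicit Types (a b c d r : R).

(* For a unit quaternion q = a + bi + cj + dk, the matrix of v |-> q v q^-1. *)
Definition quat_mx a b c d : 'M[R]_3 := mx3
  [:: [:: a ^+ 2 + b ^+ 2 - c ^+ 2 - d ^+ 2; 2 * (b * c - a * d);
          2 * (b * d + a * c)];
      [:: 2 * (b * c + a * d); a ^+ 2 - b ^+ 2 + c ^+ 2 - d ^+ 2;
          2 * (c * d - a * b)];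
      [:: 2 * (b * d - a * c); 2 * (c * d + a * b);
          a ^+ 2 - b ^+ 2 - c ^+ 2 + d ^+ 2]].

Lemma mx3_eq (M N : 'M[R]_3) :
  M 0 0 = N 0 0 -> M 0 1 = N 0 1 -> M 0 2 = N 0 2 ->
  M 1 0 = N 1 0 -> M 1 1 = N 1 1 -> M 1 2 = N 1 2 ->
  M 2 0 = N 2 0 -> M 2 1 = N 2 1 -> M 2 2 = N 2 2 -> M = N.
Proof.
move=> h00 h01 h02 h10 h11 h12 h20 h21 h22; apply/matrixP => i j.
have I3 (k : 'I_3) : [\/ k = 0, k = 1 | k = 2].
  case: k => [[|[|[|//]]] lt].
  - by apply: Or31; exact: val_inj.
  - by apply: Or32; exact: val_inj.
  - by apply: Or33; exact: val_inj.
by case: (I3 i) => ->; case: (I3 j) => ->.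
Qed.

(** Conjugation by a product is the composite of the conjugations; the arguments on the right are
    the components of the quaternion product. *)
Lemma quat_mxM a b c d a' b' c' d' :
  quat_mx a b c d *m quat_mx a' b' c' d' =
  quat_mx (a * a' - b * b' - c * c' - d * d')
          (a * b' + b * a' + c * d' - d * c')
          (a * c' - b * d' + c * a' + d * b')
          (a * d' + b * c' - c * b' + d * a').
Proof.
by apply: mx3_eq; rewrite !mxE !big_ord_recl big_ord0 !mxE /=; ring.
Qed.

(** The entries and the norm are linear in the products of two components and determine all of them,
    that is the matrix q q^T, hence q up to sign. *)
Lemma quat_mx_inj a b c d a' b' c' d' :
  a ^+ 2 + b ^+ 2 + c ^+ 2 + d ^+ 2 = 1 ->
  a' ^+ 2 + b' ^+ 2 + c' ^+ 2 + d' ^+ 2 = 1 ->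
  quat_mx a b c d = quat_mx a' b' c' d' ->
  exists e : R, [/\ e ^+ 2 = 1, a = e * a', b = e * b', c = e * c' & d = e * d'].
Proof.
move=> n n' /matrixP h.
move: (h 0 0) (h 0 1) (h 0 2) (h 1 0) (h 1 1) (h 1 2) (h 2 0) (h 2 1) (h 2 2).
rewrite !mxE /= => h00 h01 h02 h10 h11 h12 h20 h21 h22.
have aa : a ^+ 2 = a' ^+ 2 by lra.
have bb : b ^+ 2 = b' ^+ 2 by lra.
have cc : c ^+ 2 = c' ^+ 2 by lra.
have dd : d ^+ 2 = d' ^+ 2 by lra.
have ab : a * b = a' * b' by lra.
have ac : a * c = a' * c' by lra.
have ad : a * d = a' * d' by lra.
have bc : b * c = b' * c' by lra.
have bd : b * d = b' * d' by lra.
have cd : c * d = c' * d' by lra.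
(* The sign is the inner product of q and q': from q q^T = q' q'^T one gets (q'^T q) q' = q' q'^T q
   = q q^T q = q. *)
exists (a * a' + b * b' + c * c' + d * d').
have e1 : (a * a' + b * b' + c * c' + d * d') * a' = a.
  rewrite -[RHS]mulr1 -n.
  transitivity (a * a' ^+ 2 + b * (a' * b') + c * (a' * c') + d * (a' * d')); first by ring.
  by rewrite -aa -ab -ac -ad; ring.
have e2 : (a * a' + b * b' + c * c' + d * d') * b' = b.
  rewrite -[RHS]mulr1 -n.
  transitivity (a * (a' * b') + b * b' ^+ 2 + c * (b' * c') + d * (b' * d')); first by ring.
  by rewrite -bb -ab -bc -bd; ring.
have e3 : (a * a' + b * b' + c * c' + d * d') * c' = c.
  rewrite -[RHS]mulr1 -n.
  transitivity (a * (a' * c') + b * (b' * c') + c * c' ^+ 2 + d * (c' * d')); first by ring.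
  by rewrite -cc -ac -bc -cd; ring.
have e4 : (a * a' + b * b' + c * c' + d * d') * d' = d.
  rewrite -[RHS]mulr1 -n.
  transitivity (a * (a' * d') + b * (b' * d') + c * (c' * d') + d * d' ^+ 2); first by ring.
  by rewrite -dd -ad -bd -cd; ring.
clear -n n' e1 e2 e3 e4.
move: (a * a' + b * b' + c * c' + d * d') e1 e2 e3 e4 => e e1 e2 e3 e4.
split=> //; rewrite -[LHS]mulr1 -[in LHS]n'.
transitivity ((e * a') ^+ 2 + (e * b') ^+ 2 + (e * c') ^+ 2 + (e * d') ^+ 2).
  by ring.
by rewrite e1 e2 e3 e4 n.
Qed.

Lemma half_angle r : cos r = cos (r / 2) ^+ 2 - sin (r / 2) ^+ 2 /\
  sin r = 2 * cos (r / 2) * sin (r / 2).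
Proof.
have -> : r = r / 2 + r / 2 by field.
set h := r / 2; have -> : (h + h) / 2 = h by field.
by rewrite cosD sinD; split; ring.
Qed.

Lemma rot1_quat r : rot1 r = quat_mx (cos (r / 2)) (sin (r / 2)) 0 0.
Proof.
have [c s] := half_angle r; have := cos2Dsin2 (r / 2).
rewrite /rot1 c s => n.
move: (cos (r / 2)) (sin (r / 2)) n => c' s' n.
by apply: mx3_eq; rewrite !mxE /=; lra.
Qed.

Lemma rot3_quat r : rot3 r = quat_mx (cos (r / 2)) 0 0 (sin (r / 2)).
Proof.
have [c s] := half_angle r; have := cos2Dsin2 (r / 2).
rewrite /rot3 c s => n.
move: (cos (r / 2)) (sin (r / 2)) n => c' s' n.
by apply: mx3_eq; rewrite !mxE /=; lra.
Qed.

Lemma rot1N r : rot1 r *m rot1 (- r) = 1%:M.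
Proof.
have := cos2Dsin2 r; rewrite /rot1 cosN sinN.
move: (cos r) (sin r) => c s n.
by apply: mx3_eq; rewrite !mxE !big_ord_recl big_ord0 !mxE /=; lra.
Qed.

Lemma rot3N r : rot3 r *m rot3 (- r) = 1%:M.
Proof.
have := cos2Dsin2 r; rewrite /rot3 cosN sinN.
move: (cos r) (sin r) => c s n.
by apply: mx3_eq; rewrite !mxE !big_ord_recl big_ord0 !mxE /=; lra.
Qed.

End quaternions.

Section closure.
Context {R : realType}.
Implicit Types alpha beta r : R.

(** The half angle of pi - beta is complementary to beta / 2, so the half angles of [beta] combine
    into sin beta and cos beta. *)
Lemma front_quat beta rx ry rz :
  let cx := cos (rx / 2) in let sx := sin (rx / 2) in
  let cy := cos (ry / 2) in let sy := sin (ry / 2) in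
  let cz := cos (rz / 2) in let sz := sin (rz / 2) in
  rot1 rx *m rot3 beta *m rot1 ry *m rot3 (pi - beta) *m rot1 rz =
  quat_mx (- (sin beta * sy * (sx * cz + cx * sz)))
    (sin beta * sy * (cx * cz - sx * sz))
    (- ((sx * cz - cx * sz) * cy + (cx * cz + sx * sz) * sy * cos beta))
    ((cx * cz + sx * sz) * cy - (sx * cz - cx * sz) * sy * cos beta).
Proof.
move=> cx sx cy sy cz sz; rewrite !rot1_quat !rot3_quat !quat_mxM.
rewrite -/cx -/sx -/cy -/sy -/cz -/sz.
have -> : (pi - beta) / 2 = pi / 2 - beta / 2 :> R by field.
rewrite sinB cosB sin_pihalf cos_pihalf !mul0r !mul1r.
have [-> ->] := half_angle beta; have := cos2Dsin2 (beta / 2).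
move: (cos (beta / 2)) (sin (beta / 2)) cx sx cy sy cz sz.
move=> cb sb cx sx cy sy cz sz n.
(* Terms free of [beta] are multiplied by 1 = cb^2 + sb^2; the identities then become linear in the
   monomials. *)
have n1 : cx * cy * cz * (cb ^+ 2 + sb ^+ 2) = cx * cy * cz.
  by rewrite n mulr1.
have n2 : cx * cy * sz * (cb ^+ 2 + sb ^+ 2) = cx * cy * sz.
  by rewrite n mulr1.
have n3 : sx * cy * cz * (cb ^+ 2 + sb ^+ 2) = sx * cy * cz.
  by rewrite n mulr1.
have n4 : sx * cy * sz * (cb ^+ 2 + sb ^+ 2) = sx * cy * sz.
  by rewrite n mulr1.
congr quat_mx; lra.
Qed.

(** The two rotations about the third axis add up to the angle -pi, which kills the scalar
    component. *)
Lemma back_quat alpha rw :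
  rot3 (- alpha) *m rot1 (- rw) *m rot3 (- (pi - alpha)) =
  quat_mx 0 (- (sin alpha * sin (rw / 2))) (- (cos alpha * sin (rw / 2)))
    (- cos (rw / 2)).
Proof.
rewrite !rot1_quat !rot3_quat !quat_mxM.
have -> : - (pi - alpha) / 2 = - (pi / 2 - alpha / 2) :> R by field.
rewrite !mulNr !cosN !sinN sinB cosB sin_pihalf cos_pihalf !mul0r !mul1r.
have [-> ->] := half_angle alpha; have := cos2Dsin2 (alpha / 2).
move: (cos (alpha / 2)) (sin (alpha / 2)) (cos (rw / 2)) (sin (rw / 2)).
move=> ca sa cw sw n.
have n1 : cw * (ca ^+ 2 + sa ^+ 2) = cw by rewrite n mulr1.
congr quat_mx; lra.
Qed.

Lemma closure_conditionE alpha beta rx ry rz rw :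
  closure_condition alpha beta (pi - beta) (pi - alpha) rx ry rz rw <->
  rot1 rx *m rot3 beta *m rot1 ry *m rot3 (pi - beta) *m rot1 rz =
  rot3 (- alpha) *m rot1 (- rw) *m rot3 (- (pi - alpha)).
Proof.
have rot3NV r : rot3 (- r) *m rot3 r = 1%:M by rewrite -{2}[r]opprK rot3N.
have rot1NV r : rot1 (- r) *m rot1 r = 1%:M by rewrite -{2}[r]opprK rot1N.
rewrite /closure_condition -!(mulmxA (rot3 alpha)).
set L := rot1 rx *m _ *m _ *m _ *m _; split=> [h|->]; last first.
  rewrite !mulmxA rot3N mul1mx -(mulmxA (rot1 (- rw))) rot3NV mulmx1.
  exact: rot1NV.
transitivity (rot3 (- alpha) *m (rot3 alpha *m (L *m rot3 (pi - alpha) *m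
  rot1 rw)) *m rot1 (- rw) *m rot3 (- (pi - alpha))); last first.
  by rewrite h mulmx1.
rewrite !mulmxA rot3NV mul1mx -(mulmxA _ (rot1 rw)) rot1N mulmx1.
by rewrite -mulmxA rot3N mulmx1.
Qed.

(** Two unit quaternions give the same rotation exactly when they differ by a sign, here [e]. *)
Lemma closure_half_angles alpha beta rx ry rz rw :
  let cx := cos (rx / 2) in let sx := sin (rx / 2) in
  let cy := cos (ry / 2) in let sy := sin (ry / 2) in
  let cz := cos (rz / 2) in let sz := sin (rz / 2) in
  let cw := cos (rw / 2) in let sw := sin (rw / 2) in
  closure_condition alpha beta (pi - beta) (pi - alpha) rx ry rz rw <->
  exists e : R, [/\ e ^+ 2 = 1,
    sin beta * sy * (sx * cz + cx * sz) = 0,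
    sin beta * sy * (cx * cz - sx * sz) = e * (sin alpha * sw),
    (sx * cz - cx * sz) * cy + (cx * cz + sx * sz) * sy * cos beta =
      - (e * (cos alpha * sw)) &
    (cx * cz + sx * sz) * cy - (sx * cz - cx * sz) * sy * cos beta = e * cw].
Proof.
move=> cx sx cy sy cz sz cw sw.
apply: (iff_trans (closure_conditionE _ _ _ _ _ _)).
rewrite front_quat back_quat -/cx -/sx -/cy -/sy -/cz -/sz -/cw -/sw.
split; last first.
  case=> e [e2 -> -> -> ->]; rewrite /quat_mx; congr mx3.
  (* The matrix entries are quadratic, so the common sign cancels. *)
  have e2a (a b : R) : (e * a) * (e * b) = a * b.
    by rewrite mulrACA -expr2 e2 mul1r.
  by rewrite !(expr2, mulrN, mulNr, opprK, e2a, oppr0, mulr0, mul0r).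
move/quat_mx_inj => []; last 1 first.
(* The sign is flipped to absorb the minus signs of [back_quat]. *)
- move=> e [e2 h0 h1 h2 h3]; exists (- e).
  rewrite mulr0 in h0; move/eqP: h0; rewrite oppr_eq0 => /eqP h0.
  split; [by rewrite sqrrN|exact: h0|by rewrite h1; ring| |by rewrite h3; ring].
  by apply: oppr_inj; rewrite h2; ring.
(* The two remaining goals are the norm conditions of [quat_mx_inj]. *)
- have := (cos2Dsin2 beta, cos2Dsin2 (rx / 2), cos2Dsin2 (ry / 2),
           cos2Dsin2 (rz / 2)).
  rewrite -/cx -/sx -/cy -/sy -/cz -/sz => -[[[nb nx] ny] nz].
  transitivity ((cx ^+ 2 + sx ^+ 2) * (cz ^+ 2 + sz ^+ 2) *
    (cy ^+ 2 + sy ^+ 2 * (cos beta ^+ 2 + sin beta ^+ 2))); first by ring.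
  by rewrite nb nx nz !mulr1 mul1r.
- transitivity (cw ^+ 2 + sw ^+ 2 * (cos alpha ^+ 2 + sin alpha ^+ 2)).
    by ring.
  by rewrite cos2Dsin2 mulr1 cos2Dsin2.
Qed.

End closure.

(** * Half-angle tangents in homogeneous coordinates *)

Section projective_coordinates.
Context {R : realType}.
Implicit Types (r u A B C : R) (t : Rhat R).

Lemma half_nontrivial r : sin r = 0 -> cos r != 0.
Proof.
move=> s0; apply/eqP => c0; have := cos2Dsin2 r.
by rewrite s0 c0 expr0n /= addr0 => /esym/eqP; rewrite oner_eq0.
Qed.

Lemma tan_half_surj t : exists r, t = tan_half r.
Proof.
case: t => [a|].
  exists (atan a * 2); rewrite /tan_half mulfK ?pnatr_eq0 // atanK.
  by rewrite gt_eqF // cos_gt0_pihalf // atan_gtNpi2 atan_ltpi2.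
by exists pi; rewrite /tan_half cos_pihalf eqxx.
Qed.

(** Equality in homogeneous coordinates (cos : sin), which treats infinity like every other
    value. *)
Lemma tan_half_eq r u : tan_half r = tan_half u <->
  sin (r / 2) * cos (u / 2) = cos (r / 2) * sin (u / 2).
Proof.
rewrite /tan_half /tan; have nr := @half_nontrivial (r / 2).
have nu := @half_nontrivial (u / 2).
case: eqP => [cr|/eqP cr]; case: eqP => [cu|/eqP cu].
- by rewrite cr cu mulr0 mul0r.
- split=> // /eqP; rewrite cr mul0r mulf_eq0 (negbTE cu) orbF => /eqP /nr.
  by rewrite cr eqxx.
- split=> // /esym/eqP; rewrite cu mulr0 mulf_eq0 (negbTE cr) => /eqP /nu.
  by rewrite cu eqxx.
- split=> [[] /eqP|h]; first by rewrite eqr_div // => /eqP ->; rewrite mulrC.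
  by congr Some; apply/eqP; rewrite eqr_div // h mulrC.
Qed.

Lemma tan_half_eq0 r : tan_half r = Some 0 <-> sin (r / 2) = 0.
Proof.
have <- : tan_half 0 = Some 0 :> Rhat R.
  by rewrite /tan_half mul0r cos0 oner_eq0 tan0.
apply: (iff_trans (tan_half_eq _ _)).
by rewrite mul0r cos0 sin0 mulr1 mulr0.
Qed.

Lemma opp_tan_half r : opp_hat (tan_half r) = tan_half (- r).
Proof.
by rewrite /tan_half mulNr cosN; case: ifP => //= _; rewrite tanN.
Qed.

Lemma tan_half_opp r u : tan_half u = opp_hat (tan_half r) <->
  sin (r / 2) * cos (u / 2) + cos (r / 2) * sin (u / 2) = 0.
Proof.
rewrite opp_tan_half; apply: (iff_trans (tan_half_eq _ _)).
by rewrite mulNr cosN sinN; split; lra.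
Qed.

Lemma inv_tan_half r : inv_hat (tan_half r) =
  if sin (r / 2) == 0 then None else Some (cos (r / 2) / sin (r / 2)).
Proof.
rewrite /tan_half; have nr := @half_nontrivial (r / 2).
case: eqP => [cr|/eqP cr] /=.
  case: eqP => [/nr|_]; first by rewrite cr eqxx.
  by rewrite cr mul0r.
by rewrite /tan mulf_eq0 invr_eq0 (negbTE cr) orbF invf_div.
Qed.

(** Clearing denominators gives an equation that remains correct at the poles: if sin(r/2) or
    cos(r/2) vanishes, both sides of the equivalence say sin(u/2) = 0. *)
Lemma cont_ext_tan_half A B C r u : A != 0 -> B != 0 -> C != 0 ->
  inv_hat (tan_half u) =
    cont_ext (fun s => - ((A * s ^+ 2 + B) / (2 * s * C))) (tan_half r) <->
  C * sin r * cos (u / 2) =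
    - (A * sin (r / 2) ^+ 2 + B * cos (r / 2) ^+ 2) * sin (u / 2).
Proof.
move=> A0 B0 C0; rewrite cont_ext_quadratic // inv_tan_half.
have [_ ->] := half_angle r.
have nr := @half_nontrivial (r / 2); have nu := @half_nontrivial (u / 2).
rewrite /tan_half; case: (eqVneq (cos (r / 2)) 0) => [cr|cr].
  rewrite cr mulr0 mul0r mulr0 mul0r expr0n /= mulr0 addr0.
  case: (eqVneq (sin (u / 2)) 0) => [->|su]; first by rewrite mulr0.
  split=> // /esym/eqP.
  rewrite mulf_eq0 (negbTE su) orbF oppr_eq0 mulf_eq0 (negbTE A0) /=.
  by rewrite sqrf_eq0 => /eqP/nr; rewrite cr eqxx.
rewrite /tan mulf_eq0 invr_eq0 (negbTE cr) orbF.
case: (eqVneq (sin (r / 2)) 0) => [sr|sr].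
  rewrite sr !mulr0 mul0r expr0n /= mulr0 add0r.
  case: (eqVneq (sin (u / 2)) 0) => [->|su]; first by rewrite mulr0.
  split=> // /esym/eqP.
  by rewrite mulf_eq0 (negbTE su) orbF oppr_eq0 mulf_eq0 (negbTE B0) sqrf_eq0
    (negbTE cr).
case: (eqVneq (sin (u / 2)) 0) => [su|su].
  split=> // /eqP; rewrite su mulr0 !mulf_eq0 (negbTE C0) (negbTE cr).
  by rewrite (negbTE sr) pnatr_eq0 /= => /eqP cu; have := nu su; rewrite cu eqxx.
have -> : - ((A * (sin (r / 2) / cos (r / 2)) ^+ 2 + B) /
    (2 * (sin (r / 2) / cos (r / 2)) * C)) =
  - (A * sin (r / 2) ^+ 2 + B * cos (r / 2) ^+ 2) /
    (C * (2 * cos (r / 2) * sin (r / 2))).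
  by field; rewrite C0 cr sr.
split=> [[/eqP]|h].
  rewrite eqr_div ?mulf_neq0 ?pnatr_eq0 // => /eqP h.
  by rewrite -h; ring.
congr Some; apply/eqP; rewrite eqr_div ?mulf_neq0 ?pnatr_eq0 //.
by rewrite -h; apply/eqP; ring.
Qed.

End projective_coordinates.

(** * Solving the closure equations in half angles *)

Section half_angle_algebra.
Context {R : realFieldType}.

(** The vector (c, s) is orthogonal to (P, N), hence a multiple of (-N, P). The factor [k] is the
    inner product with (-N, P) over its squared length, and unit length of (c, s) fixes k^2. *)
Lemma unit_kernel (N P c s : R) : c ^+ 2 + s ^+ 2 = 1 ->
  N ^+ 2 + P ^+ 2 != 0 -> P * c = - N * s ->
  exists k, [/\ k ^+ 2 * (N ^+ 2 + P ^+ 2) = 1, c = - (N * k) & s = P * k].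
Proof.
move=> n D0 h; exists ((s * P - c * N) / (N ^+ 2 + P ^+ 2)); split.
- have -> : ((s * P - c * N) / (N ^+ 2 + P ^+ 2)) ^+ 2 * (N ^+ 2 + P ^+ 2) =
      ((c ^+ 2 + s ^+ 2) * (N ^+ 2 + P ^+ 2) - (P * c - - N * s) ^+ 2) /
      (N ^+ 2 + P ^+ 2) by field.
  by rewrite h subrr expr0n /= subr0 n mul1r divff.
- apply: (mulIf D0); rewrite mulNr -mulrA divfK //.
  have -> : c * (N ^+ 2 + P ^+ 2) = c * N ^+ 2 + P * (P * c) by ring.
  by rewrite h; ring.
- apply: (mulIf D0); rewrite -mulrA divfK //.
  have -> : s * (N ^+ 2 + P ^+ 2) = P * (s * P) - N * (- N * s) by ring.
  by rewrite -h; ring.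
Qed.

Lemma sum_sqr_eq0 (a b : R) : a ^+ 2 + b ^+ 2 = 0 -> a = 0 /\ b = 0.
Proof.
move=> /eqP; rewrite paddr_eq0 ?sqr_ge0 // !sqrf_eq0.
by case/andP => /eqP -> /eqP ->.
Qed.

Variables ca sa cb sb : R.
Hypothesis na : ca ^+ 2 + sa ^+ 2 = 1.
Hypothesis nb : cb ^+ 2 + sb ^+ 2 = 1.
Hypotheses (sa0 : sa != 0) (sb0 : sb != 0).
Hypothesis sBA : sb * ca - cb * sa != 0.
Hypothesis sDA : sb * ca + cb * sa != 0.

Variables c s : R.
Hypothesis ncs : c ^+ 2 + s ^+ 2 = 1.

(* With c = cos rho_x and s = sin rho_x, the second branch reads
   cot (rho_y / 2) = - N / P and cot (rho_w / 2) = - N' / P'. *)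
Let N := ca * sb + c * (sa * cb).
Let P := sa * s.
Let N' := cb * sa + c * (sb * ca).
Let P' := sb * s.

(** Both sides equal 1 - (ca cb - c sa sb)^2, which is symmetric in the two angles. The circle
    coordinates of y and w thus share a denominator. *)
Lemma denominator_sym : N ^+ 2 + P ^+ 2 = N' ^+ 2 + P' ^+ 2.
Proof.
have -> : N' ^+ 2 + P' ^+ 2 = N ^+ 2 + P ^+ 2 + ((1 - c ^+ 2) *
  (sa ^+ 2 * cb ^+ 2 - sb ^+ 2 * ca ^+ 2) + s ^+ 2 * (sb ^+ 2 - sa ^+ 2)).
  by rewrite /N /N' /P /P'; ring.
have -> : 1 - c ^+ 2 = s ^+ 2 by rewrite -ncs; ring.
have -> : cb ^+ 2 = 1 - sb ^+ 2 by rewrite -nb; ring.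
have -> : ca ^+ 2 = 1 - sa ^+ 2 by rewrite -na; ring.
by ring.
Qed.

(** Vanishing forces s = 0, so c = 1 or c = -1, where [N] is sin(beta + alpha) or sin(beta - alpha);
    [sDA] and [sBA] exclude both. *)
Lemma denominator_neq0 : N ^+ 2 + P ^+ 2 != 0.
Proof.
apply/eqP => /sum_sqr_eq0[] /eqP N0 /eqP.
rewrite mulf_eq0 (negbTE sa0) => /eqP s0.
have s2 : 1 - c ^+ 2 = s ^+ 2 by rewrite -ncs; ring.
have : (1 - c) * (1 + c) == 0.
  by rewrite -subr_sqr expr1n s2 s0 expr0n.
rewrite mulf_eq0 subr_eq0 addr_eq0 => /orP[/eqP c1|/eqP c1].
  move: N0; rewrite /N -c1 => /eqP N0; move/eqP: sDA; apply.
  by rewrite -N0; ring.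
have {}c1 : c = - 1 by rewrite c1 opprK.
move: N0; rewrite /N c1 => /eqP N0; move/eqP: sBA; apply.
by rewrite -N0; ring.
Qed.

Variables cx sx cy sy cz sz cw sw : R.
Hypothesis nx : cx ^+ 2 + sx ^+ 2 = 1.
Hypothesis ny : cy ^+ 2 + sy ^+ 2 = 1.
Hypothesis nz : cz ^+ 2 + sz ^+ 2 = 1.
Hypothesis nw : cw ^+ 2 + sw ^+ 2 = 1.
Hypothesis cE : c = cx ^+ 2 - sx ^+ 2.
Hypothesis sE : s = 2 * cx * sx.

Lemma sqr1_neq0 (a : R) : a ^+ 2 = 1 -> a != 0.
Proof. by move=> h; rewrite -sqrf_eq0 h oner_neq0. Qed.

(** The hypothesis is sin((rho_x + rho_z)/2) = 0, so [o], the cosine of that angle, is a sign and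
    (cz, sz) = o (cx, -sx). *)
Lemma opposite_half_angle : sx * cz + cx * sz = 0 ->
  let o := cx * cz - sx * sz in
  [/\ o ^+ 2 = 1, cx * cz + sx * sz = o * c & sx * cz - cx * sz = o * s].
Proof.
move=> h o.
have ez : cz = cx * o.
  rewrite -[LHS]mul1r -nx /o.
  transitivity (cx * (cx * cz - sx * sz) + sx * (sx * cz + cx * sz)).
    by ring.
  by rewrite h mulr0 addr0.
have es : sz = - (sx * o).
  rewrite -[LHS]mul1r -nx /o.
  transitivity (- (sx * (cx * cz - sx * sz)) + cx * (sx * cz + cx * sz)).
    by ring.
  by rewrite h mulr0 addr0.
split.
- transitivity ((cx ^+ 2 + sx ^+ 2) * (cz ^+ 2 + sz ^+ 2) -
    (sx * cz + cx * sz) ^+ 2); first by rewrite /o; ring.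
  by rewrite h nx nz expr0n /= subr0 mulr1.
- by rewrite ez es cE; ring.
- by rewrite ez es sE; ring.
Qed.

(** The product equation splits the solutions into the two branches; the other equations are then
    solved on each branch by eliminating [e]. *)
Lemma closure_half_anglesP :
  (exists e : R, [/\ e ^+ 2 = 1,
    sb * sy * (sx * cz + cx * sz) = 0,
    sb * sy * (cx * cz - sx * sz) = e * (sa * sw),
    (sx * cz - cx * sz) * cy + (cx * cz + sx * sz) * sy * cb =
      - (e * (ca * sw)) &
    (cx * cz + sx * sz) * cy - (sx * cz - cx * sz) * sy * cb = e * cw]) <->
  [/\ sx * cz = cx * sz, sy = 0 & sw = 0] \/
  [/\ sx * cz + cx * sz = 0, P * cy = - N * sy & P' * cw = - N' * sw].
Proof.
split=> [[e [e2 E1 E2 E3 E4]]|[[xz y0 w0]|[xz Py Pw]]].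
- have e0 := sqr1_neq0 e e2.
  move/eqP: (E1); rewrite !mulf_eq0 (negbTE sb0) /= => /orP[/eqP y0|/eqP xz].
    left; have cy0 : cy != 0.
      by apply: sqr1_neq0; rewrite -ny y0 expr0n addr0.
    have w0 : sw = 0.
      apply/eqP; move/esym/eqP: E2; rewrite y0 mulr0 mul0r !mulf_eq0.
      by rewrite (negbTE e0) (negbTE sa0).
    split=> //; apply/eqP; move/eqP: E3.
    rewrite y0 w0 !(mulr0, mul0r, addr0) oppr0 mulf_eq0 (negbTE cy0) orbF.
    by rewrite subr_eq0.
  right; have [ho2 oc os] := opposite_half_angle xz.
  rewrite oc os in E3 E4; set o := cx * cz - _ in ho2 E2 E3 E4 *.
  have o0 := sqr1_neq0 o ho2.
  (* Multiplying [E3] by [sa] and replacing [e * (sa * sw)] through [E2] eliminates [sw]. *)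
  have Py : P * cy = - N * sy.
    apply: (mulfI o0).
    have -> : o * (P * cy) = sa * (o * s * cy + o * c * sy * cb) -
      o * c * sy * cb * sa by rewrite /P; ring.
    rewrite E3.
    have -> : sa * - (e * (ca * sw)) = - (ca * (e * (sa * sw))) by ring.
    by rewrite -E2 /N; ring.
  split=> //; apply: (mulfI (mulf_neq0 e0 sa0)).
  have -> : e * sa * (P' * cw) = sa * P' * (e * cw) by ring.
  have -> : e * sa * (- N' * sw) = - N' * (e * (sa * sw)) by ring.
  rewrite -E2 -E4.
  have -> : sa * P' * (o * c * cy - o * s * sy * cb) =
    sb * o * (c * (P * cy) - s ^+ 2 * sa * sy * cb) by rewrite /P /P'; ring.
  rewrite Py.
  have -> : s ^+ 2 = 1 - c ^+ 2 by rewrite -ncs; ring.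
  by rewrite /N /N'; ring.
- have cy2 : cy ^+ 2 = 1 by rewrite -ny y0 expr0n addr0.
  have cw2 : cw ^+ 2 = 1 by rewrite -nw w0 expr0n addr0.
  have ho2 : (cx * cz + sx * sz) ^+ 2 = 1.
    transitivity ((cx ^+ 2 + sx ^+ 2) * (cz ^+ 2 + sz ^+ 2) -
      (sx * cz - cx * sz) ^+ 2); first by ring.
    by rewrite xz nx nz subrr expr0n /= subr0 mulr1.
  (* With sy = sw = 0 only the last equation is nontrivial, and cw^2 = 1 solves it for [e]. *)
  exists ((cx * cz + sx * sz) * cy * cw); rewrite y0 w0 xz subrr.
  split; rewrite ?(mulr0, mul0r, addr0, subr0, oppr0) //.
    by rewrite !exprMn ho2 cy2 cw2 !mulr1.
  by rewrite -mulrA -expr2 cw2 mulr1.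
have [ho2 oc os] := opposite_half_angle xz.
have D0 := denominator_neq0; have D0' := D0; rewrite denominator_sym in D0'.
have [k [k2 ey ez]] := unit_kernel N P cy sy ny D0 Py.
have [k' [k2' ew ez']] := unit_kernel N' P' cw sw nw D0' Pw.
set o := cx * cz - sx * sz in ho2 oc os *.
pose D := N ^+ 2 + P ^+ 2.
have DN : D = N' ^+ 2 + P' ^+ 2 := denominator_sym.
have kk (x : R) : k' ^+ 2 * D * x = x by rewrite DN k2' mul1r.
(* Inserting sy = k P and sw = k' P' in the second equation suggests e = o k / k', and 1 / k' = k' D
   because k'^2 D = 1. *)
exists (o * k * k' * D); rewrite oc os xz mulr0.
have s2 : s ^+ 2 = 1 - c ^+ 2 by rewrite -ncs; ring.
split=> //.
- transitivity (o ^+ 2 * (k ^+ 2 * D) * (k' ^+ 2 * D)); first by ring.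
  by rewrite ho2 k2 DN k2' !mulr1.
- rewrite ez ez'.
  transitivity (k' ^+ 2 * D * (o * k * sa * P')); last by ring.
  by rewrite kk /P /P'; ring.
- rewrite ey ez ez'.
  transitivity (- (k' ^+ 2 * D * (o * k * ca * P'))); last by ring.
  by rewrite kk /N /P /P'; ring.
- rewrite ey ez ew.
  transitivity (- (k' ^+ 2 * D * (o * k * N'))); last by ring.
  rewrite kk.
  transitivity (- (o * k * (c * N + s ^+ 2 * sa * cb))).
    by rewrite /N /P; ring.
  by rewrite s2 /N /N'; ring.
Qed.

End half_angle_algebra.

(** * The two branches *)

Section circle_parametrization.
Context {R : realType}.

Definition circle_point (t : Rhat R) : 'rV[R]_2 :=
  \row_(j < 2) nth 0 [:: (circle_coords t).1; (circle_coords t).2] j.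

Lemma circle_point_unit t : @unit_circle R (circle_point t).
Proof.
have [r ->] := tan_half_surj t.
by rewrite /unit_circle /= !mxE /= circle_coords_tan_half cos2Dsin2.
Qed.

Lemma circle_point_surj v : @unit_circle R v -> exists t, v = circle_point t.
Proof.
rewrite /unit_circle /=; set c := v 0 0; set s := v 0 1 => ncs.
have vE t : circle_coords t = (c, s) -> v = circle_point t.
  move=> h; apply/rowP => -[[|[|//]] lt]; rewrite mxE h /=.
    by congr (v _ _); exact: val_inj.
  by congr (v _ _); exact: val_inj.
case: (eqVneq (1 + c) 0) => [c1|c1].
  exists None; apply: vE => /=.
  have cE : c = - 1 by apply/eqP; rewrite -addr_eq0 addrC c1.
  move: ncs; rewrite cE sqrrN expr1n => /eqP.
  by rewrite -subr_eq0 addrAC subrr add0r sqrf_eq0 => /eqP ->.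
(* This is the half-angle formula tan(rho/2) = sin rho / (1 + cos rho). *)
exists (Some (s / (1 + c))); apply: vE => /=.
have s2 : s ^+ 2 = (1 - c) * (1 + c) by rewrite -subr_sqr expr1n -ncs; ring.
have aE : (s / (1 + c)) ^+ 2 = (1 - c) / (1 + c).
  by rewrite expr_div_n s2; field.
have dE : 1 + (s / (1 + c)) ^+ 2 = 2 / (1 + c) by rewrite aE; field.
by rewrite dE aE; congr pair; field.
Qed.

(** The inverse map is the linear projection to the first two coordinates, the circle point of x, so
    only the parametrization [F] needs a smoothness check. *)
Lemma diffeomorphic_to_circle_of_param (B : set (Rhat4 R))
    (F : 'rV[R]_2 -> seq R) :
  (forall (j : 'I_8) k, class_C k setT (fun v => (F v)`_j)) ->
  (forall t, exists y z w, B (t, y, z, w)) ->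
  (forall x y z w, B (x, y, z, w) ->
     torus_embed (x, y, z, w) = \row_(j < 8) (F (circle_point x))`_j) ->
  diffeomorphic_to_circle B.
Proof.
move=> smF Bsurj BF.
pose f (v : 'rV[R]_2) : 'rV[R]_8 := \row_j (F v)`_j.
pose g (u : 'rV[R]_8) : 'rV[R]_2 := \row_(j < 2) u 0 (@widen_ord 2 8 isT j).
have gE x y z w : g (torus_embed (x, y, z, w)) = circle_point x.
  by apply/rowP => -[[|[|//]] lt]; rewrite !mxE.
exists f, g; split.
- split=> v _.
    exists setT, f; split=> //; first exact: openT.
    move=> j k; rewrite (_ : (fun _ => _) = (fun v => (F v)`_j)) //.
    by apply/funext => u; rewrite mxE.
  exists setT, g; split=> //; first exact: openT.
  move=> j k.
  rewrite (_ : (fun _ => _) = (fun u : 'rV[R]_8 => u 0 (@widen_ord 2 8 isT j))).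
    exact: class_C_coord.
  by apply/funext => u; rewrite mxE.
- move=> v /circle_point_surj[t ->]; have [y [z [w Bt]]] := Bsurj t.
  rewrite /f -(BF _ _ _ _ Bt); split; last exact: gE.
  by exists (t, y, z, w).
- move=> _ [[[[x y] z] w] Bp <-]; rewrite gE.
  by split; [exact: circle_point_unit | rewrite (BF _ _ _ _ Bp)].
Qed.

End circle_parametrization.

Section branches.
Context {R : realType}.

Lemma branch1_circle : diffeomorphic_to_circle (branch1 (R := R)).
Proof.
apply: (diffeomorphic_to_circle_of_param _
  (fun v => [:: v 0 0; v 0 1; 1; 0; v 0 0; v 0 1; 1; 0])).
- move=> [j lt]; move: lt => /=.
  do 8 (case: j => [_|j] /=; first solve [exact: smooth_coord|exact: smooth_cst]).
  by [].
- by move=> t; exists (Some 0), t, (Some 0), t.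
- move=> x y z w [t [-> -> -> ->]].
  apply/rowP => -[j lt]; rewrite !mxE /=; move: lt.
  do 8 (case: j => [_|j] /=; first by rewrite ?expr0n /= ?mulr0 ?addr0
    ?subr0 ?mul0r ?divr1).
  by [].
Qed.

Variables alpha beta : R.
Let ca := cos alpha.
Let sa := sin alpha.
Let cb := cos beta.
Let sb := sin beta.
Hypotheses (sa0 : sa != 0) (sb0 : sb != 0).
Hypothesis sBA : sin (beta - alpha) != 0.
Hypothesis sDA : sin (beta + alpha) != 0.

Let N (c : R) := ca * sb + c * (sa * cb).
Let P (s : R) := sa * s.
Let N' (c : R) := cb * sa + c * (sb * ca).
Let P' (s : R) := sb * s.

(** Expanding sin(beta - alpha) and sin(beta + alpha) turns the quadratic forms in the half angle of
    rho_x into [N] and [N'], affine in cos rho_x. *)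
Lemma branch2_half_angles rx ry rz rw :
  branch2 alpha beta (tan_half rx, tan_half ry, tan_half rz, tan_half rw) <->
  [/\ sin (rx / 2) * cos (rz / 2) + cos (rx / 2) * sin (rz / 2) = 0,
      P (sin rx) * cos (ry / 2) = - N (cos rx) * sin (ry / 2) &
      P' (sin rx) * cos (rw / 2) = - N' (cos rx) * sin (rw / 2)].
Proof.
have sAB : sin (alpha - beta) != 0 by rewrite -opprB sinN oppr_eq0.
have sDB : sin (alpha + beta) != 0 by rewrite addrC.
have [cE _] := half_angle rx; have nx := cos2Dsin2 (rx / 2).
have NE : sin (beta - alpha) * sin (rx / 2) ^+ 2 +
    sin (beta + alpha) * cos (rx / 2) ^+ 2 = N (cos rx).
  rewrite sinB sinD /N cE -/ca -/sa -/cb -/sb.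
  transitivity (ca * sb * (cos (rx / 2) ^+ 2 + sin (rx / 2) ^+ 2) +
    (cos (rx / 2) ^+ 2 - sin (rx / 2) ^+ 2) * (sa * cb)); first by ring.
  by rewrite nx mulr1.
have NE' : sin (alpha - beta) * sin (rx / 2) ^+ 2 +
    sin (alpha + beta) * cos (rx / 2) ^+ 2 = N' (cos rx).
  rewrite sinB sinD /N' cE -/ca -/sa -/cb -/sb.
  transitivity (cb * sa * (cos (rx / 2) ^+ 2 + sin (rx / 2) ^+ 2) +
    (cos (rx / 2) ^+ 2 - sin (rx / 2) ^+ 2) * (sb * ca)); first by ring.
  by rewrite nx mulr1.
rewrite /branch2 /=; split.
  case=> t [<-] /(cont_ext_tan_half _ _ _ _ _ sBA sDA sa0) hy
    /tan_half_opp hz /(cont_ext_tan_half _ _ _ _ _ sAB sDB sb0) hw.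
  by rewrite -NE -NE'.
case=> hz hy hw; exists (tan_half rx); split=> //.
- by apply/(cont_ext_tan_half _ _ _ _ _ sBA sDA sa0); rewrite NE.
- exact/tan_half_opp.
- by apply/(cont_ext_tan_half _ _ _ _ _ sAB sDB sb0); rewrite NE'.
Qed.

Lemma config_spaceE :
  config_space alpha beta (pi - beta) (pi - alpha) =
  branch1 (R := R) `|` branch2 alpha beta.
Proof.
have sBA' : sb * ca - cb * sa != 0 by rewrite -sinB.
have sDA' : sb * ca + cb * sa != 0 by rewrite -sinD.
have key rx ry rz rw :
    closure_condition alpha beta (pi - beta) (pi - alpha) rx ry rz rw <->
    (branch1 (R := R) `|` branch2 alpha beta)
      (tan_half rx, tan_half ry, tan_half rz, tan_half rw).
  apply: (iff_trans (closure_half_angles _ _ _ _ _ _)).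
  have [cE sE] := half_angle rx.
  apply: (iff_trans (closure_half_anglesP ca sa cb sb (cos2Dsin2 _)
    (cos2Dsin2 _) sa0 sb0 sBA' sDA' _ _ (cos2Dsin2 rx) _ _ _ _ _ _ _ _
    (cos2Dsin2 _) (cos2Dsin2 _) (cos2Dsin2 _) (cos2Dsin2 _) cE sE)).
  split=> [[[xz y0 w0]|h]|[[t [xt y0 zt w0]]|h]].
  - left; exists (tan_half rx); congr (_, _, _, _).
    + exact/tan_half_eq0.
    + exact/esym/tan_half_eq.
    + exact/tan_half_eq0.
  - by right; apply/branch2_half_angles.
  - left; split; [|exact/tan_half_eq0..].
    by apply/tan_half_eq; rewrite xt zt.
  - by right; move/branch2_half_angles: h.
apply/seteqP; split=> [p [rx [ry [rz [rw [h ->]]]]]|]; first exact/key.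
move=> [[[x y] z] w].
have [rx ->] := tan_half_surj x; have [ry ->] := tan_half_surj y.
have [rz ->] := tan_half_surj z; have [rw ->] := tan_half_surj w.
by move=> /key h; exists rx, ry, rz, rw.
Qed.

(** The half-angle vector is k (-n, p), and the double-angle formulas contain only k^2 = 1 / (n^2 +
    p^2). The sign of [k] drops out and the circle coordinates are rational in [n] and [p]. *)
Lemma unit_kernel_angle (n p r : R) : n ^+ 2 + p ^+ 2 != 0 ->
  p * cos (r / 2) = - n * sin (r / 2) ->
  circle_coords (tan_half r) =
    ((n ^+ 2 - p ^+ 2) / (n ^+ 2 + p ^+ 2), - (2 * n * p) / (n ^+ 2 + p ^+ 2)).
Proof.
move=> D0 /(unit_kernel _ _ _ _ (cos2Dsin2 _) D0) [k [k2 ck sk]].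
rewrite circle_coords_tan_half; have [-> ->] := half_angle r.
rewrite ck sk; congr pair; apply: (mulIf D0); rewrite divfK //.
  transitivity (k ^+ 2 * (n ^+ 2 + p ^+ 2) * (n ^+ 2 - p ^+ 2)); first by ring.
  by rewrite k2 mul1r.
transitivity (k ^+ 2 * (n ^+ 2 + p ^+ 2) * (- (2 * n * p))); first by ring.
by rewrite k2 mul1r.
Qed.

(* The last summand vanishes on the unit circle and makes the denominator
   positive on the whole plane. *)
Let D (c s : R) := N c ^+ 2 + P s ^+ 2 + (c ^+ 2 + s ^+ 2 - 1) ^+ 2.

Lemma branch2_circle : diffeomorphic_to_circle (branch2 alpha beta).
Proof.
have sBA' : sb * ca - cb * sa != 0 by rewrite -sinB.
have sDA' : sb * ca + cb * sa != 0 by rewrite -sinD.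
have na : ca ^+ 2 + sa ^+ 2 = 1 by exact: cos2Dsin2.
have nb : cb ^+ 2 + sb ^+ 2 = 1 by exact: cos2Dsin2.
have D0 c s : D c s != 0.
  apply/eqP => /eqP.
  rewrite paddr_eq0 ?sqr_ge0 ?addr_ge0 ?sqr_ge0 // => /andP[/eqP h].
  rewrite sqrf_eq0 subr_eq0 => /eqP ncs.
  by have := denominator_neq0 ca sa cb sb sa0 sBA' sDA' c s ncs; rewrite h eqxx.
apply: (diffeomorphic_to_circle_of_param _ (fun v =>
  let c := v 0 0 in let s := v 0 1 in
  [:: c; s; (N c ^+ 2 - P s ^+ 2) / D c s; - (2 * N c * P s) / D c s;
      c; - s; (N' c ^+ 2 - P' s ^+ 2) / D c s;
      - (2 * N' c * P' s) / D c s])).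
- have smD : smooth_fun (fun v : 'rV[R]_2 => (D (v 0 0) (v 0 1))^-1).
    apply: smoothV => [v|]; first exact: D0.
    by do ?[exact: smooth_coord|exact: smooth_cst|apply: smoothD|
      apply: smoothX|apply: smoothM|apply: smoothN].
  move=> [j lt]; move: lt => /=.
  do 8 (case: j => [_|j] /=; first by
    do ?[exact: smD|exact: smooth_coord|exact: smooth_cst|apply: smoothM|
      apply: smoothD|apply: smoothX|apply: smoothN]).
  by [].
- move=> t; have [rx ->] := tan_half_surj t.
  (* As [inv_hat] is an involution, inverting the prescribed values of y^-1 and w^-1 gives a point
     of the branch above every x. *)
  have inv (u : Rhat R) : inv_hat (inv_hat u) = u.
    case: u => [a|] /=; last by rewrite eqxx.
    by case: eqVneq => [->//|a0] /=; rewrite invr_eq0 (negbTE a0) invrK.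
  do 3 eexists; exists (tan_half rx); split; [by []|exact: inv|by []|exact: inv].
move=> x y z w Bp; move: Bp.
have [rx ->] := tan_half_surj x; have [ry ->] := tan_half_surj y.
have [rz ->] := tan_half_surj z; have [rw ->] := tan_half_surj w.
move=> /[dup] /branch2_half_angles[_ hy hw] [t [<- _ -> _]].
have ncs := cos2Dsin2 rx.
have DE : D (cos rx) (sin rx) = N (cos rx) ^+ 2 + P (sin rx) ^+ 2.
  by rewrite /D ncs subrr expr0n addr0.
have DE' : D (cos rx) (sin rx) = N' (cos rx) ^+ 2 + P' (sin rx) ^+ 2.
  by rewrite DE; exact: denominator_sym.
have Dn := D0 (cos rx) (sin rx).
have yE := unit_kernel_angle _ _ _ _ hy; rewrite -DE in yE.
have wE := unit_kernel_angle _ _ _ _ hw; rewrite -DE' in wE.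
rewrite opp_tan_half.
apply/rowP => j; rewrite !mxE (yE Dn) (wE Dn) !circle_coords_tan_half /=.
by rewrite cosN sinN.
Qed.

End branches.

Theorem mainTheorem10 (R : realType) (alpha beta gamma delta : R)
  (halpha : 0 < alpha < pi) (hbeta : 0 < beta < pi)
  (hgamma : 0 < gamma < pi) (hdelta : 0 < delta < pi)
  (hda : delta = pi - alpha) (hgb : gamma = pi - beta)
  (hne : beta <> alpha) (hsum : alpha + beta <> pi) :
  [/\ config_space alpha beta gamma delta =
        branch1 (R := R) `|` branch2 alpha beta,
      diffeomorphic_to_circle (branch1 (R := R)) &
      diffeomorphic_to_circle (branch2 alpha beta)].
Proof.
rewrite hda hgb; have [[a0 api] [b0 bpi]] := (andP halpha, andP hbeta).
have sa0 : sin alpha != 0 by rewrite gt_eqF // sin_gt0_pi.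
have sb0 : sin beta != 0 by rewrite gt_eqF // sin_gt0_pi.
have sBA : sin (beta - alpha) != 0.
  (* The difference lies strictly between -pi and pi and is nonzero. *)
  case: (ltgtP alpha beta) => [ab|ba|/esym//].
    by rewrite gt_eqF // sin_gt0_pi //; apply/andP; split; lra.
  rewrite -opprB sinN oppr_eq0 gt_eqF // sin_gt0_pi //; apply/andP; split; lra.
have sDA : sin (beta + alpha) != 0.
  case: (ltgtP (alpha + beta) pi) => [lt|gt|//].
    by rewrite gt_eqF // sin_gt0_pi //; apply/andP; split; lra.
  (* Here the sum lies between pi and 2 pi; it is shifted back by pi. *)
  rewrite -[_ + _](subrK pi) sinDpi oppr_eq0 gt_eqF // sin_gt0_pi //.
  by apply/andP; split; lra.
split; [exact: config_spaceE|exact: branch1_circle|exact: branch2_circle].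
Qed.
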